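(* Let $T=(T_1,\dots,T_n)$ be a weighted shift on $\mathcal{H}_n$ with weights $\Lambda=\{\lambda_{i,w}\}$ and weight function $W$, and suppose that $$\sup_{1\le i\le n,\ w\in\mathbb{F}_n^+} W(i,w)\,W(e,w)^{-1}<\infty .$$ For $1\le i\le n$ let $S_i\in\mathcal{B}(\mathcal{H}_n)$ be the operator defined by $$S_i\xi_w=\mu_{i,w}\,\xi_{wi},\qquad \mu_{i,w}=W(i,w)\,W(e,w)^{-1},\qquad w\in\mathbb{F}_n^+ .$$ Let $\mathfrak{R}_\Lambda$ be the unital WOT-closed algebra generated by $\{S_1,\dots,S_n\}$. Then the commutant of $\mathfrak{R}_\Lambda$ in $\mathcal{B}(\mathcal{H}_n)$ coincides with $\mathfrak{L}_\Lambda$.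
   Context: Let $n\ge 2$ and let $\mathbb{F}_n^+$ be the unital free semigroup on $n$ noncommuting letters $\{1,\dots,n\}$, with unit $e$ (the empty word). Fock space is $\mathcal{H}_n=\ell^2(\mathbb{F}_n^+)$ with orthonormal basis $\{\xi_w: w\in\mathbb{F}_n^+\}$. A weighted shift on $\mathcal{H}_n$ with weights $\Lambda=\{\lambda_{i,w}: 1\le i\le n,\ w\in\mathbb{F}_n^+\}$ is an $n$-tuple $T=(T_1,\dots,T_n)$ of bounded operators on $\mathcal{H}_n$ with $T_i\xi_w=\lambda_{i,w}\xi_{iw}$ for all $i,w$; throughout, all $\lambda_{i,w}>0$ (and $\sup_{i,w}\lambda_{i,w}<\infty$ by boundedness). $\mathfrak{L}_\Lambda$ denotes the unital weak-operator-topology (WOT) closed algebra generated by $\{T_1,\dots,T_n\}$. The weight function $W:\mathbb{F}_n^+\times\mathbb{F}_n^+\to\mathbb{R}_+$ is $W(u,e)=1$ and $W(u,w)=\lambda_{i_1,u}\lambda_{i_2,i_1u}\cdots\lambda_{i_k,i_{k-1}\cdots i_1u}$ for $w=i_k\cdots i_1$. *)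

(* Defs.v *)
From HB Require Import structures.
From mathcomp Require Import all_boot all_order all_algebra.
From mathcomp Require Import complex.
From mathcomp Require Import all_classical all_reals.
From mathcomp Require Import ereal numfun esum topology normedtype.
From mathcomp Require Import ring lra.

Set Implicit Arguments.
Unset Strict Implicit.
Unset Printing Implicit Defensive.
Import Order.TTheory GRing.Theory Num.Theory.
Local Open Scope classical_set_scope.
Local Open Scope complex_scope.
Local Open Scope ring_scope.

Definition sqnormc (R : realType) (z : R[i]) : R := complex.Re z ^+ 2 + complex.Im z ^+ 2.

Section sqnormc_theory.
Variable R : realType.
Implicit Types z w : R[i].

Lemma sqnormc_ge0 z : 0 <= sqnormc z.
Proof. by rewrite addr_ge0 ?sqr_ge0. Qed.

Lemma sqnormcE z : (sqnormc z)%:C = `|z| ^+ 2.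
Proof. exact: add_Re2_Im2. Qed.

Lemma sqnormcM z w : sqnormc (z * w) = sqnormc z * sqnormc w.
Proof. by case: z w => [a b] [c d]; rewrite /sqnormc /=; ring. Qed.

Lemma sqnormcD z w : sqnormc (z + w) <= 2 * (sqnormc z + sqnormc w).
Proof.
case: z w => [a b] [c d]; rewrite /sqnormc /= -subr_ge0.
have -> : 2 * (a ^+ 2 + b ^+ 2 + (c ^+ 2 + d ^+ 2)) -
  ((a + c) ^+ 2 + (b + d) ^+ 2) = (a - c) ^+ 2 + (b - d) ^+ 2 by ring.
by rewrite addr_ge0 ?sqr_ge0.
Qed.

End sqnormc_theory.

(* The word i_k ... i_1 is the list [:: i_k; ...; i_1]: the product of words is
   concatenation, the unit is [::], and iw, wi are i :: w, rcons w i. *)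
Notation word n := (seq 'I_n).

Section fock_space.
Variables (R : realType) (n : nat).
Implicit Types f g : word n -> R[i].

Definition sqsum f : \bar R := (\esum_(w in [set: word n]) (sqnormc (f w))%:E)%E.

Definition l2 : {pred word n -> R[i]} := fun f => (sqsum f < +oo)%E.

Lemma sqsum_ge0 f : (0 <= sqsum f)%E.
Proof. by apply: esum_ge0 => w _; rewrite lee_fin sqnormc_ge0. Qed.

Lemma sqsum0 : sqsum (fun=> 0) = 0%E.
Proof. by apply: esum1 => w _; rewrite /sqnormc /= expr0n /= addr0. Qed.

Lemma esumZ_le (c : R) (f : word n -> R) : 0 <= c -> (forall w, 0 <= f w) ->
  (\esum_(w in [set: word n]) (c * f w)%:E <=
   c%:E * \esum_(w in [set: word n]) (f w)%:E)%E.
Proof.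
move=> c0 f0; apply: ge_ereal_sup => _ [X [finX XI] <-].
have -> : (\sum_(w \in X) (c * f w)%:E = c%:E * \sum_(w \in X) (f w)%:E)%E.
  by rewrite ge0_mule_fsumr.
apply: lee_wpmul2l; first by rewrite lee_fin.
by apply: ereal_sup_ubound; exists X.
Qed.

Lemma sqsumZ a f : (sqsum (fun w => a * f w)%R <= (sqnormc a)%:E * sqsum f)%E.
Proof.
rewrite /sqsum; under eq_esum do rewrite sqnormcM.
by apply: esumZ_le => [|w]; exact: sqnormc_ge0.
Qed.

Lemma sqsumD f g : (sqsum (fun w => f w + g w)%R <= 2%:E * (sqsum f + sqsum g))%E.
Proof.
rewrite /sqsum -esumD; last 2 first.
- by move=> w _; rewrite lee_fin sqnormc_ge0.
- by move=> w _; rewrite lee_fin sqnormc_ge0.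
apply: (@le_trans _ _ (\esum_(w in [set: word n])
    (2 * (sqnormc (f w) + sqnormc (g w)))%:E)%E).
  by apply: le_esum => w _; rewrite lee_fin sqnormcD.
by apply: esumZ_le => // w; rewrite addr_ge0 ?sqnormc_ge0.
Qed.

Lemma l2_submod_closed : submod_closed l2.
Proof.
split; first by rewrite /in_mem /= /l2 sqsum0 ltry.
move=> a f g; rewrite /in_mem /= /l2 => fl gl.
have := sqsumD (fun w => a * f w) g; move/le_lt_trans; apply.
rewrite lte_mul_pinfty// lte_add_pinfty//.
by apply: le_lt_trans (sqsumZ a f) _; rewrite lte_mul_pinfty ?lee_fin ?sqnormc_ge0.
Qed.

HB.instance Definition _ :=
  GRing.isSubmodClosed.Build R[i] (word n -> R[i]) l2 l2_submod_closed.

Record fock := Fock { fock_val :> word n -> R[i]; _ : fock_val \in l2 }.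

HB.instance Definition _ := [isSub for fock_val].
HB.instance Definition _ := [Choice of fock by <:].
HB.instance Definition _ := [SubChoice_isSubLmodule of fock by <:].


Implicit Types x y : fock.

Lemma xi_subproof (w : word n) : (fun v => (v == w)%:R : R[i]) \in l2.
Proof.
rewrite /in_mem /= /l2 /sqsum (esumID [set w]) => [|v _]; last first.
  by rewrite lee_fin sqnormc_ge0.
rewrite setTI esum_set1 ?lee_fin ?sqnormc_ge0// eqxx esum1 ?adde0 ?ltry// => v.
by move=> [_ /= /eqP/negPf ->]; rewrite /sqnormc /= expr0n /= addr0.
Qed.

Definition xi (w : word n) : fock := Fock (xi_subproof w).

(* esum is only meaningful for nonnegative families; an absolutely summable
   family is summed through positive and negative parts. Only such families
   occur in inner, by the Cauchy-Schwarz inequality. *)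
Definition rsum (r : word n -> R) : R :=
  fine (\esum_(w in [set: word n]) (EFin \o r)^\+ w -
        \esum_(w in [set: word n]) (EFin \o r)^\- w)%E.

Definition csum f : R[i] :=
  (rsum (fun w => complex.Re (f w))) +i* (rsum (fun w => complex.Im (f w))).

Definition inner x y : R[i] := csum (fun w => x w * conjc (y w)).

Definition fnorm x : R := Num.sqrt (fine (sqsum x)).

Definition bounded_operator : {pred fock -> fock} := fun A =>
  `[< linear A /\ exists M : R, forall x, fnorm (A x) <= M * fnorm x >].

Lemma fnorm_ge0 x : 0 <= fnorm x. Proof. exact: sqrtr_ge0. Qed.

Lemma sqsum_fin x : sqsum x \is a fin_num.
Proof. by rewrite ge0_fin_numE ?sqsum_ge0//; case: x. Qed.

Lemma fnorm_sqr x : ((fnorm x ^+ 2)%:E = sqsum x)%E.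
Proof. by rewrite sqr_sqrtr ?fineK ?sqsum_fin// fine_ge0 ?sqsum_ge0. Qed.

Lemma fnorm0 : fnorm 0 = 0.
Proof. by rewrite /fnorm [sqsum _]sqsum0 sqrtr0. Qed.

Lemma fnormZ_le a x : fnorm (a *: x) <= Num.sqrt (sqnormc a) * fnorm x.
Proof.
rewrite -ler_sqr ?nnegrE ?mulr_ge0 ?fnorm_ge0 ?sqrtr_ge0//.
rewrite exprMn (sqr_sqrtr (sqnormc_ge0 a)) -lee_fin [leRHS]EFinM !fnorm_sqr.
exact: sqsumZ.
Qed.

Lemma fnormD_le x y : fnorm (x + y) <= 2 * (fnorm x + fnorm y).
Proof.
rewrite -ler_sqr ?nnegrE ?mulr_ge0 ?addr_ge0 ?fnorm_ge0//.
apply: (@le_trans _ _ (2 * (fnorm x ^+ 2 + fnorm y ^+ 2))).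
  have : (sqsum (x + y : fock)%R <= 2%:E * (sqsum x + sqsum y))%E by exact: sqsumD.
  by rewrite -!fnorm_sqr -EFinD -EFinM lee_fin.
by have := fnorm_ge0 x; have := fnorm_ge0 y; nra.
Qed.

Lemma bounded_operator_submod_closed : submod_closed bounded_operator.
Proof.
split.
  apply/asboolP; split; first by move=> a x y; rewrite scaler0 addr0.
  by exists 0 => x; rewrite mul0r [fnorm _]fnorm0.
move=> a A B /asboolP[lA [M AM]] /asboolP[lB [N BN]]; apply/asboolP; split.
  move=> b x y; rewrite !fctE lA lB !scalerDr !scalerA [a * b]mulrC.
  by rewrite addrACA.
exists (2 * (Num.sqrt (sqnormc a) * M + N)) => x.
apply: le_trans (fnormD_le _ _) _.
rewrite -mulrA ler_pM2l// mulrDl lerD//.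
apply: le_trans (fnormZ_le _ _) _.
by rewrite -mulrA ler_wpM2l ?sqrtr_ge0.
Qed.

HB.instance Definition _ := GRing.isSubmodClosed.Build R[i] (fock -> fock)
  bounded_operator bounded_operator_submod_closed.

Record bop :=
  Bop { bop_val :> fock -> fock; _ : bop_val \in bounded_operator }.

HB.instance Definition _ := [isSub for bop_val].
HB.instance Definition _ := [Choice of bop by <:].
HB.instance Definition _ := [SubChoice_isSubLmodule of bop by <:].

Lemma bop_linear (A : bop) : linear A.
Proof. by have /asboolP[] := valP A. Qed.

HB.instance Definition _ (A : bop) :=
  GRing.isLinear.Build R[i] fock fock _ A (bop_linear A).

Lemma bop_bounded (A : bop) : exists M : R, forall x, fnorm (A x) <= M * fnorm x.
Proof. by have /asboolP[] := valP A. Qed.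

Lemma bop_ext (A B : bop) : A =1 B -> A = B.
Proof. by move=> AB; apply/val_inj/funext. Qed.

Lemma bop1_subproof : (id : fock -> fock) \in bounded_operator.
Proof. by apply/asboolP; split => //; exists 1 => x; rewrite mul1r. Qed.

Lemma bopM_subproof (A B : bop) :
  ((A : fock -> fock) \o (B : fock -> fock)) \in bounded_operator.
Proof.
apply/asboolP; split; first by move=> a x y; rewrite /= !linearP.
have [M AM] := bop_bounded A; have [N BN] := bop_bounded B.
exists (`|M| * `|N|) => x /=; apply: le_trans (AM _) _.
rewrite -mulrA; apply: (@le_trans _ _ (`|M| * fnorm (B x))).
  by rewrite ler_wpM2r ?fnorm_ge0 ?ler_norm.
rewrite ler_wpM2l//; apply: le_trans (BN _) _.
by rewrite ler_wpM2r ?fnorm_ge0 ?ler_norm.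
Qed.

Definition bop1 : bop := Bop bop1_subproof.
Definition bopM (A B : bop) : bop := Bop (bopM_subproof A B).

Lemma bopMA : associative bopM. Proof. by move=> A B C; exact: bop_ext. Qed.
Lemma bop1M : left_id bop1 bopM. Proof. by move=> A; exact: bop_ext. Qed.
Lemma bopM1 : right_id bop1 bopM. Proof. by move=> A; exact: bop_ext. Qed.
Lemma bopMDl : left_distributive bopM +%R.
Proof. by move=> A B C; exact: bop_ext. Qed.
Lemma bopMDr : right_distributive bopM +%R.
Proof. by move=> A B C; apply: bop_ext => x /=; rewrite linearD. Qed.
Lemma bop1_neq0 : bop1 != 0.
Proof.
apply/eqP => /(congr1 (fun A : bop => A (xi [::]) [::]))/eqP.
by rewrite /= oner_eq0.
Qed.

HB.instance Definition _ := GRing.Zmodule_isNzRing.Build bop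
  bopMA bop1M bopM1 bopMDl bopMDr bop1_neq0.

Lemma bop_scalerAl (a : R[i]) (A B : bop) : a *: (A * B) = (a *: A) * B.
Proof. exact: bop_ext. Qed.

HB.instance Definition _ := GRing.Lmodule_isLalgebra.Build R[i] bop bop_scalerAl.

Lemma bop_scalerAr (a : R[i]) (A B : bop) : a *: (A * B) = A * (a *: B).
Proof. by apply: bop_ext => x /=; rewrite linearZ. Qed.

HB.instance Definition _ := GRing.Lalgebra_isAlgebra.Build R[i] bop bop_scalerAr.

(* The weak operator topology is the coarsest topology on B(H) making every
   A |-> <A x, y> continuous. *)
Definition matrix_coef (A : bop) : {ptws (fock * fock)%type -> R[i]^o} :=
  fun xy => inner (A xy.1) xy.2.

Definition wot : Type := initial_topology matrix_coef.

HB.instance Definition _ := Topological.on wot.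

Definition wot_alg (G : set bop) : set bop :=
  smallest [set D : set bop | subalg_closed [in D] /\ closed (D : set wot)] G.

Definition commutant (D : set bop) : set bop :=
  [set B | forall A, D A -> A * B = B * A].

Implicit Types lam : 'I_n -> word n -> R.

(* For w = i_k ... i_1, weight lam u w is
   lam i_1 u * lam i_2 (i_1 u) * ... * lam i_k (i_{k-1} ... i_1 u). *)
Fixpoint weight lam (u w : word n) : R :=
  if w is i :: v then weight lam u v * lam i (v ++ u) else 1.

(* W(i,w) W(e,w)^-1, where the letter i is the one-letter word [:: i]. *)
Definition right_weight lam (i : 'I_n) (w : word n) : R :=
  weight lam [:: i] w * (weight lam [::] w)^-1.

Definition weighted_shift lam (T : 'I_n -> bop) : Prop :=
  (forall i w, 0 < lam i w) /\
  (forall i w, T i (xi w) = (lam i w)%:C *: xi (i :: w)).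

Definition right_shift lam (S : 'I_n -> bop) : Prop :=
  forall i w, S i (xi w) = (right_weight lam i w)%:C *: xi (rcons w i).

Section shift_existence.
Variables (f : word n -> word n) (m : word n -> R) (M : R).
Hypotheses (finj : injective f) (mM : forall w, `|m w| <= M).

Let g (v : word n) : option (word n) :=
  if pselect (exists w, f w = v) is left h then Some (projT1 (cid h)) else None.

Let gf w : g (f w) = Some w.
Proof.
rewrite /g; case: pselect => [h|[]]; last by exists w.
by case: cid => u /= /finj ->.
Qed.

Let gN v : ~ range f v -> g v = None.
Proof.
by rewrite /g; case: pselect => // -[w fw] []; exists w.
Qed.

Let sh (x : word n -> R[i]) (v : word n) : R[i] :=
  if g v is Some w then (m w)%:C * x w else 0.

Let sqsum_sh x : (sqsum (sh x) <= (M ^+ 2)%:E * sqsum x)%E.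
Proof.
have -> : sqsum (sh x) = (\esum_(w in [set: word n])
    (sqnormc ((m w)%:C * x w)%R)%:E)%E.
  rewrite /sqsum (esumID (range f)) => [|v _]; last first.
    by rewrite lee_fin sqnormc_ge0.
  rewrite !setTI [X in (_ + X)%E]esum1 ?adde0 => [|v vf]; last first.
    by rewrite /sh gN// /sqnormc /= expr0n /= addr0.
  rewrite esum_image; last by move=> u v _ _; exact: finj.
  by apply: eq_esum => w _; rewrite /sh gf.
have M0 : 0 <= M by apply: le_trans (mM [::]).
apply: (@le_trans _ _ (\esum_(w in [set: word n])
    (M ^+ 2 * sqnormc (x w))%:E)%E); last first.
  by apply: esumZ_le => [|w]; rewrite ?sqr_ge0 ?sqnormc_ge0.
apply: le_esum => w _; rewrite lee_fin sqnormcM ler_wpM2r ?sqnormc_ge0//.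
rewrite /sqnormc /= expr0n /= addr0 -[leLHS]real_normK ?num_real//.
by rewrite ler_sqr ?nnegrE.
Qed.

Let sh_l2 (x : fock) : sh x \in l2.
Proof.
rewrite /in_mem /= /l2; apply: le_lt_trans (sqsum_sh x) _.
by rewrite lte_mul_pinfty ?lee_fin ?sqr_ge0//; case: x.
Qed.

Let sh_bounded : (fun x => Fock (sh_l2 x)) \in bounded_operator.
Proof.
apply/asboolP; split.
  move=> a x y; apply/val_inj/funext => v /=.
  rewrite !fctE /= /sh; case: (g v) => [w|]; last by rewrite scaler0 addr0.
  by rewrite mulrDr -[a *: _]/(a * _) mulrCA.
have M0 : 0 <= M by apply: le_trans (mM [::]).
exists M => x; rewrite -ler_sqr ?nnegrE ?mulr_ge0 ?fnorm_ge0// exprMn.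
by rewrite -lee_fin [leRHS]EFinM !fnorm_sqr; exact: sqsum_sh.
Qed.

Lemma shift_exists :
  exists A : bop, forall w, A (xi w) = (m w)%:C *: xi (f w).
Proof.
exists (Bop sh_bounded) => w; apply/val_inj/funext => v /=.
rewrite !fctE /= /sh; have [[u _ <-]|vf] := pselect (range f v).
  by rewrite gf (inj_eq finj); case: eqP => [->|_]; rewrite ?mulr0 ?scaler0.
rewrite gN//; case: eqP => [vE|_]; last by rewrite scaler0.
by case: vf; exists w.
Qed.

End shift_existence.

Lemma right_shift_exists lam : (forall i w, 0 < lam i w) ->
  has_ubound [set right_weight lam p.1 p.2 | p in [set: 'I_n * word n]] ->
  exists S, right_shift lam S.
Proof.
move=> lam0 [M muM].
have W0 u w : 0 < weight lam u w.
  by elim: w => //= i w IH; rewrite mulr_gt0.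
suff /choice[S SE] i : exists A : bop, forall w,
    A (xi w) = (right_weight lam i w)%:C *: xi (rcons w i) by exists S.
apply: (@shift_exists (rcons^~ i) (right_weight lam i) M); first exact: rcons_injl.
move=> w; rewrite gtr0_norm; last by rewrite divr_gt0.
by apply: muM; exists (i, w).
Qed.

End fock_space.

(* Main.v *)
Require Import Defs.
From mathcomp Require Import all_boot all_order all_algebra.
From mathcomp Require Import complex.
From mathcomp Require Import all_classical all_reals.
From mathcomp Require Import ereal numfun esum topology normedtype sequences.
From mathcomp Require Import ring lra zify.

(* The T_i commute with the S_j, and the centralizer of one bounded operator B
   is a WOT-closed algebra (A |-> <BAx, xi_v> is a WOT-continuous coefficient
   because z |-> (Bz)(v) is an inner product, by the Riesz argument); this gives
   one inclusion.

   For the other, an operator A commuting with the S_i is determined by A xi_e: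
   (A xi_u)(wu) = a_w W(u,w) with a_w = (A xi_e)(w) / W(e,w), and all other
   matrix entries of A vanish. The Cesaro means
     C_N = sum_(|w| <= N) (1 - |w|/(N+1)) a_w T_w
   are polynomials in the T_i whose matrix is that of A multiplied entrywise by
   k(|u|,|v|) = (1 - ||v|-|u||/(N+1))_+ . This kernel is the average
   (1/(N+1)) sum_m q_m(|u|) q_m(|v|), where q_m is the indicator of
   a <= m < a+N+1, so that C_N = (1/(N+1)) sum_m Q_m A Q_m with Q_m a coordinate
   projection and sum_m Q_m = N+1. Cauchy-Schwarz then bounds the C_N uniformly,
   and entrywise convergence upgrades to WOT convergence C_N -> A. *)

Set Implicit Arguments.
Unset Strict Implicit.
Unset Printing Implicit Defensive.
Import Order.TTheory GRing.Theory Num.Theory.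
Import Normc.
Local Open Scope classical_set_scope.
Local Open Scope complex_scope.
Local Open Scope ring_scope.

(** * Inner product *)

Section summation.
Variables (R : realType) (n : nat).
Implicit Types (f g h r : word n -> R) (c : R).

Let summ r := summable [set: word n] (EFin \o r).
Let total f : R := fine (\esum_(w in [set: word n]) (f w)%:E)%E.

Lemma summable_le h r : summ h -> (forall w, `|r w| <= h w) -> summ r.
Proof.
move=> + rh; apply: le_lt_trans; apply: le_esum => w _ /=.
by rewrite lee_fin (le_trans (rh w))// ler_norm.
Qed.

Lemma summable_add f g : summ f -> summ g -> summ (fun w => f w + g w).
Proof. exact: summableD. Qed.

Lemma summable_scale c f : summ f -> summ (fun w => c * f w).
Proof.
move=> sf; apply: (@le_lt_trans _ _
    (\esum_(w in [set: word n]) (`|c| * `|f w|)%:E)%E).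
  by apply: le_esum => w _ /=; rewrite normrM.
by apply: le_lt_trans (esumZ_le _ _) _ => //; rewrite lte_mul_pinfty ?lee_fin.
Qed.

Lemma esum_fin f : summ f -> (forall w, 0 <= f w) ->
  (\esum_(w in [set: word n]) (f w)%:E)%E \is a fin_num.
Proof.
move=> + f0; rewrite /summ summableE; congr (_ \is a fin_num).
by apply: eq_esum => w _ /=; rewrite ger0_norm.
Qed.

Lemma total_ge0 f : (forall w, 0 <= f w) -> 0 <= total f.
Proof. by move=> f0; rewrite fine_ge0// esum_ge0// => w _; rewrite lee_fin. Qed.

Lemma totalD f g : summ f -> summ g ->
  (forall w, 0 <= f w) -> (forall w, 0 <= g w) ->
  total (fun w => f w + g w) = total f + total g.
Proof.
move=> sf sg f0 g0; rewrite /total -fineD ?esum_fin// -esumD// => w _;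
  by rewrite lee_fin.
Qed.

Lemma le_total f g : summ g -> (forall w, 0 <= f w) -> (forall w, f w <= g w) ->
  total f <= total g.
Proof.
move=> sg f0 fg; have sf : summ f.
  by apply: summable_le sg _ => w; rewrite ger0_norm.
have g0 w : 0 <= g w by apply: le_trans (fg w).
by apply: fine_le; rewrite ?esum_fin//; apply: le_esum => w _; rewrite lee_fin.
Qed.

Lemma totalZ_le c f : summ f -> 0 <= c -> (forall w, 0 <= f w) ->
  total (fun w => c * f w) <= c * total f.
Proof.
move=> sf c0 f0; rewrite /total -lee_fin EFinM !fineK ?esum_fin//.
  exact: esumZ_le.
- exact: summable_scale.
- by move=> w; rewrite mulr_ge0.
Qed.

Lemma totalZ c f : summ f -> 0 <= c -> (forall w, 0 <= f w) ->
  total (fun w => c * f w) = c * total f.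
Proof.
move=> sf + f0; rewrite le_eqVlt => /predU1P[<-|c0].
  rewrite mul0r /total esum1// => w _; by rewrite mul0r.
apply/le_anti; rewrite totalZ_le ?(ltW c0)//=.
(* The reverse inequality is [totalZ_le] for the factor [c^-1] applied to [c * f]. *)
rewrite -ler_pdivlMl//.
have <- : total (fun w => c^-1 * (c * f w)) = total f.
  by congr total; apply/funext => w; rewrite mulKf ?gt_eqF.
apply: totalZ_le; first exact: summable_scale.
- by rewrite invr_ge0 ltW.
- by move=> w; rewrite mulr_ge0 ?(ltW c0).
Qed.

(** [rsum] is defined through positive and negative parts, which do not add up under sums; allowing
    any difference of nonnegative summable families makes additivity and homogeneity immediate. *)
Lemma rsum_decomp r f g : summ f -> summ g ->
  (forall w, 0 <= f w) -> (forall w, 0 <= g w) -> (forall w, r w = f w - g w) ->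
  rsum r = total f - total g.
Proof.
move=> sf sg f0 g0 rE; rewrite /total -fineB ?esum_fin//; congr fine.
have -> : EFin \o r = ((EFin \o f) \- (EFin \o g))%E.
  by apply/funext => w /=; rewrite rE.
by rewrite esumB// => w _; rewrite lee_fin.
Qed.

Let ppart r w := Num.max (r w) 0.
Let npart r w := Num.max (- r w) 0.
Let part_facts r w : [/\ 0 <= ppart r w, 0 <= npart r w,
  r w = ppart r w - npart r w & `|r w| = ppart r w + npart r w].
Proof.
rewrite /ppart /npart; case: (lerP 0 (r w)) => h.
  by rewrite max_r ?oppr_le0// subr0 addr0 ger0_norm.
have h0 : 0 <= - r w by rewrite oppr_ge0 ltW.
by rewrite (max_l h0) sub0r add0r opprK ltr0_norm.
Qed.

Lemma rsum_parts r : summ r -> exists f g, [/\ summ f, summ g,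
  forall w, 0 <= f w /\ 0 <= g w, forall w, r w = f w - g w &
  forall w, `|r w| = f w + g w].
Proof.
move=> sr; exists (ppart r), (npart r).
have sa : summ (fun w => `|r w|).
  by apply: le_lt_trans sr; apply: le_esum => w _ /=; rewrite normr_id.
split=> [| |w|w|w]; try by have [] := part_facts r w.
- by apply: summable_le sa _ => w; have [p q _ ->] := part_facts r w;
    rewrite ger0_norm// lerDl.
- by apply: summable_le sa _ => w; have [p q _ ->] := part_facts r w;
    rewrite ger0_norm// lerDr.
Qed.

Lemma rsumD f g : summ f -> summ g ->
  rsum (fun w => f w + g w) = rsum f + rsum g.
Proof.
move=> /rsum_parts[p [q [sp sq pq0 fE _]]] /rsum_parts[p' [q' [sp' sq' pq0' gE _]]].
have [p0 q0] : (forall w, 0 <= p w) /\ (forall w, 0 <= q w).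
  by split=> w; case: (pq0 w).
have [p0' q0'] : (forall w, 0 <= p' w) /\ (forall w, 0 <= q' w).
  by split=> w; case: (pq0' w).
rewrite (rsum_decomp sp sq p0 q0 fE) (rsum_decomp sp' sq' p0' q0' gE).
rewrite (@rsum_decomp _ (fun w => p w + p' w) (fun w => q w + q' w)).
- by rewrite !totalD//; ring.
- exact: summable_add.
- exact: summable_add.
- by move=> w; rewrite addr_ge0.
- by move=> w; rewrite addr_ge0.
- by move=> w; rewrite fE gE; ring.
Qed.

Lemma rsumZ c f : summ f -> rsum (fun w => c * f w) = c * rsum f.
Proof.
move=> /rsum_parts[p [q [sp sq pq0 fE _]]].
have [p0 q0] : (forall w, 0 <= p w) /\ (forall w, 0 <= q w).
  by split=> w; case: (pq0 w).
rewrite (rsum_decomp sp sq p0 q0 fE).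
have [c0|c0] := lerP 0 c.
  rewrite (@rsum_decomp _ (fun w => c * p w) (fun w => c * q w)).
  - by rewrite !totalZ//; ring.
  - exact: summable_scale.
  - exact: summable_scale.
  - by move=> w; rewrite mulr_ge0.
  - by move=> w; rewrite mulr_ge0.
  - by move=> w; rewrite fE; ring.
(* A negative factor exchanges the roles of [p] and [q]. *)
have nc0 : 0 <= - c by rewrite oppr_ge0 ltW.
rewrite (@rsum_decomp _ (fun w => - c * q w) (fun w => - c * p w)).
- by rewrite !totalZ//; ring.
- exact: summable_scale.
- exact: summable_scale.
- by move=> w; rewrite mulr_ge0.
- by move=> w; rewrite mulr_ge0.
- by move=> w; rewrite fE; ring.
Qed.

Lemma rsum_le r h : summ h -> (forall w, `|r w| <= h w) -> `|rsum r| <= total h.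
Proof.
move=> sh rh; have [p [q [sp sq pq0 fE aE]]] := rsum_parts (summable_le sh rh).
have [p0 q0] : (forall w, 0 <= p w) /\ (forall w, 0 <= q w).
  by split=> w; case: (pq0 w).
rewrite (rsum_decomp sp sq p0 q0 fE).
apply: (@le_trans _ _ (total (fun w => p w + q w))).
  rewrite totalD// (le_trans (ler_normB _ _))// !ger0_norm ?total_ge0//.
by apply: le_total => // w; rewrite -?aE// rh.
Qed.

Lemma rsum_delta (v : word n) c : rsum (fun w => c * (w == v)%:R) = c.
Proof.
have d0 w : 0 <= ((w == v)%:R : R) by rewrite ler0n.
have dE : (\esum_(w in [set: word n]) ((w == v)%:R : R)%:E = 1)%E.
  rewrite (esumID [set v]); last by move=> w _; rewrite lee_fin.
  rewrite setTI esum_set1 ?eqxx// esum1 ?adde0// => w [_ /= /eqP/negPf ->//].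
have sd : summ (fun w => (w == v)%:R).
  rewrite /summ /summable; under eq_esum => w _ do rewrite /= normr_nat.
  by rewrite dE ltry.
rewrite rsumZ// (@rsum_decomp _ (fun w => (w == v)%:R) (fun=> 0))//.
- by rewrite /total dE esum1//= subr0 mulr1.
- by rewrite /summ /summable esum1 ?ltry// => w _ /=; rewrite normr0.
- by move=> w; rewrite subr0.
Qed.

End summation.

(** * Real-valued modulus of complex numbers *)

Section complex_norm.
Variable R : realType.
Implicit Types z w : R[i].

Lemma normc_ge0 z : 0 <= normc z.
Proof. by case: z => a b; exact: sqrtr_ge0. Qed.

Lemma normcD z w : normc (z + w) <= normc z + normc w.
Proof. exact: le_normcD. Qed.

Lemma normcB z w : normc (z - w) <= normc z + normc w.
Proof. by rewrite -[normc w]normcN; exact: normcD. Qed.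

Lemma normc_conj z : normc (conjc z) = normc z.
Proof. by case: z => a b; rewrite /= sqrrN. Qed.

Lemma normc_real (c : R) : normc c%:C = `|c|.
Proof. by rewrite /= expr0n /= addr0 sqrtr_sqr. Qed.

Lemma normc_sqr z : normc z ^+ 2 = sqnormc z.
Proof. by case: z => a b; rewrite sqr_sqrtr// addr_ge0// sqr_ge0. Qed.

Lemma normc_le_ReIm z : normc z <= `|complex.Re z| + `|complex.Im z|.
Proof.
case: z => a b; rewrite -ler_sqr ?nnegrE ?sqrtr_ge0 ?addr_ge0//=.
rewrite sqr_sqrtr ?addr_ge0 ?sqr_ge0// sqrrD !real_normK ?num_real//.
by rewrite lerD2r lerDl mulrn_wge0// mulr_ge0.
Qed.

Lemma normc_sum (I : Type) (s : seq I) (F : I -> R[i]) :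
  normc (\sum_(i <- s) F i) <= \sum_(i <- s) normc (F i).
Proof.
elim/big_ind2: _ => [|x1 x2 y1 y2 h1 h2|//]; first by rewrite normc0.
by apply: le_trans (normcD _ _) _; exact: lerD.
Qed.

Lemma sqnormc_conjM z : z * conjc z = (sqnormc z)%:C.
Proof. by rewrite sqnormcE sqr_normc. Qed.

Lemma normc_small_eq0 z C : (forall e : R, 0 < e -> normc z <= C * e) -> z = 0.
Proof.
move=> zC; apply/eq0_normc/le_anti; rewrite normc_ge0 andbT.
have [C0|C0] := lerP C 0.
  by apply: le_trans (zC 1 ltr01) _; rewrite mulr1.
apply/ler_addgt0Pl => e e0; rewrite addr0.
by have := zC (e / C) (divr_gt0 e0 C0); rewrite mulrCA divff ?gt_eqF// mulr1.
Qed.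

(** In the order of [R[i]] a positive number is real; this turns the complex tolerance in statements
    of convergence into a real one. *)
Lemma gt0_complexP z : 0 < z -> exists2 r : R, 0 < r & z = r%:C.
Proof.
case: z => a b; rewrite ltcE /= => /andP[/eqP b0 a0].
by exists a => //; rewrite b0.
Qed.

End complex_norm.

Section inner_product.
Variables (R : realType) (n : nat).
Implicit Types (f g : word n -> R[i]) (x y z : fock R n).

Let csummable f :=
  summable [set: word n] (EFin \o (fun w => complex.Re (f w))) /\
  summable [set: word n] (EFin \o (fun w => complex.Im (f w))).

Lemma csumD f g : csummable f -> csummable g ->
  csum (fun w => f w + g w) = csum f + csum g.
Proof.
move=> [fr fi] [gr gi]; rewrite /csum; apply/eqP; rewrite eq_complex /=.
by apply/andP; split; apply/eqP; rewrite -rsumD//; congr rsum;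
  apply/funext => w; case: (f w) (g w) => [a b] [c d].
Qed.

Lemma csumZ a f : csummable f -> csum (fun w => a * f w) = a * csum f.
Proof.
move=> [fr fi]; rewrite /csum; case: a => b c; apply/eqP; rewrite eq_complex /=.
apply/andP; split; apply/eqP.
  rewrite -mulNr -!rsumZ// -rsumD; try exact: summable_scale.
  by congr rsum; apply/funext => w; case: (f w) => d e /=; ring.
rewrite -!rsumZ// -rsumD; try exact: summable_scale.
by congr rsum; apply/funext => w; case: (f w) => d e /=; ring.
Qed.

Lemma csum_conj f : csummable f -> csum (fun w => conjc (f w)) = conjc (csum f).
Proof.
move=> [fr fi]; rewrite /csum; apply/eqP; rewrite eq_complex /=.
apply/andP; split; apply/eqP.
  by congr rsum; apply/funext => w; case: (f w).
rewrite -mulN1r -rsumZ//.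
by congr rsum; apply/funext => w; case: (f w) => d e /=; ring.
Qed.

(** A summable majorant for the real and imaginary parts of the terms of [inner x y], by 2|ab| <=
    a^2 + b^2. *)
Let sq2 x y w := sqnormc (x w) + sqnormc (y w).

Let l2_summable x :
  summable [set: word n] (EFin \o (fun w => sqnormc (x w))).
Proof.
case: x => x /= xl; apply: le_lt_trans xl; apply: le_esum => w _ /=.
by rewrite ger0_norm// sqnormc_ge0.
Qed.

Let sq2_summable x y : summable [set: word n] (EFin \o sq2 x y).
Proof. exact: summable_add. Qed.

Let Re_le x y w : `|complex.Re (x w * conjc (y w))| <= sq2 x y w.
Proof.
rewrite /sq2 /sqnormc; case: (x w) (y w) => [a b] [c d] /=.
rewrite ler_norml; have := sqr_ge0 (a - c); have := sqr_ge0 (a + c).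
have := sqr_ge0 (b - d); have := sqr_ge0 (b + d).
have := sqr_ge0 a; have := sqr_ge0 b; have := sqr_ge0 c; have := sqr_ge0 d.
by rewrite !expr2 => *; apply/andP; split; nra.
Qed.

Let Im_le x y w : `|complex.Im (x w * conjc (y w))| <= sq2 x y w.
Proof.
rewrite /sq2 /sqnormc; case: (x w) (y w) => [a b] [c d] /=.
rewrite ler_norml; have := sqr_ge0 (a - d); have := sqr_ge0 (a + d).
have := sqr_ge0 (b - c); have := sqr_ge0 (b + c).
have := sqr_ge0 a; have := sqr_ge0 b; have := sqr_ge0 c; have := sqr_ge0 d.
by rewrite !expr2 => *; apply/andP; split; nra.
Qed.

Let inner_summable x y : csummable (fun w => x w * conjc (y w)).
Proof.
split; apply: summable_le (sq2_summable x y) _ => w; first exact: Re_le.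
exact: Im_le.
Qed.

Lemma innerC x y : inner y x = conjc (inner x y).
Proof.
rewrite /inner -csum_conj//; congr csum; apply/funext => w.
by rewrite rmorphM /= conjcK mulrC.
Qed.

Lemma inner_linearl y : scalar (fun x => inner x y : R[i]).
Proof.
move=> a x x'; have sx := inner_summable x y.
rewrite /inner -csumZ// -csumD//.
  congr csum; apply/funext => w.
  rewrite -[(a *: x + x' : fock R n) w]/(a * x w + x' w).
  by rewrite mulrDl mulrA.
have axE w : (a *: x : fock R n) w * conjc (y w) = a * (x w * conjc (y w)).
  by rewrite -[(a *: x : fock R n) w]/(a * x w) mulrA.
have [p q] := inner_summable (a *: x) y.
by split; [move: p|move: q]; congr (is_true (summable _ _)); apply/funext => w;
  rewrite /= axE.
Qed.

Lemma inner_xi x v : inner x (xi R v) = x v.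
Proof.
rewrite /inner /csum; case E : (x v) => [a b]; congr (_ +i* _).
  rewrite -[RHS](rsum_delta v); congr rsum; apply/funext => w /=.
  have [->|_] := eqVneq w v; first by rewrite E; rewrite conjc1 mulr1 mulr1.
  by rewrite conjc0 !mulr0.
rewrite -[RHS](rsum_delta v); congr rsum; apply/funext => w /=.
have [->|_] := eqVneq w v; first by rewrite E; rewrite conjc1 mulr1 mulr1.
by rewrite conjc0 !mulr0.
Qed.

(** The factor 2 comes from bounding the real and the imaginary part separately by the total of
    [sq2]; the constant need not be sharp. *)
Lemma inner_le_sqr x y : normc (inner x y) <= 2 * (fnorm x ^+ 2 + fnorm y ^+ 2).
Proof.
have tE z : fine (\esum_(w in [set: word n]) (sqnormc (z w))%:E)%E = fnorm z ^+ 2.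
  by rewrite -[RHS]/(fine (fnorm z ^+ 2)%:E) fnorm_sqr.
have sE : fine (\esum_(w in [set: word n]) (sq2 x y w)%:E)%E =
    fnorm x ^+ 2 + fnorm y ^+ 2.
  by rewrite totalD ?tE// => w; exact: sqnormc_ge0.
apply: le_trans (normc_le_ReIm _) _; rewrite mulr_natl mulr2n -sE.
by apply: lerD; apply: rsum_le.
Qed.

Lemma fnorm_eq0 x : fnorm x = 0 -> x = 0.
Proof.
move=> x0; apply/val_inj/funext => w /=; apply/eq0_normc/eqP.
rewrite -sqrf_eq0 normc_sqr eq_le sqnormc_ge0 andbT.
rewrite -lee_fin; apply: (@le_trans _ _ (sqsum x)); last first.
  by rewrite -fnorm_sqr x0 expr0n.
rewrite /sqsum (esumID [set w]) => [|v _]; last by rewrite lee_fin sqnormc_ge0.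
rewrite setTI esum_set1 ?lee_fin ?sqnormc_ge0// leeDl// esum_ge0// => v _.
by rewrite lee_fin sqnormc_ge0.
Qed.

Lemma fnormZ_real_le (t : R) x : 0 <= t -> fnorm (t%:C *: x) <= t * fnorm x.
Proof.
move=> t0; apply: le_trans (fnormZ_le _ _) _.
by rewrite /sqnormc /= expr0n addr0 sqrtr_sqr ger0_norm.
Qed.

(** Rescaling [x] until its norm is at most that of [y] turns a bound by a sum of squares into a
    bound by a product. It serves both the inner product and the Cesaro forms. *)
Lemma homogeneous_bound (b : fock R n -> fock R n -> R[i]) (K : R) :
  (forall (t : R) x y, b (t%:C *: x) y = t%:C * b x y) ->
  (forall x, b x 0 = 0) ->
  (forall x y, normc (b x y) <= K * (fnorm x ^+ 2 + fnorm y ^+ 2)) ->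
  forall x y, normc (b x y) <= 2 * K * (fnorm x * fnorm y).
Proof.
move=> bZ b0 bK x y.
have [x0|x0] := eqVneq (fnorm x) 0.
  rewrite x0 mul0r mulr0 (fnorm_eq0 x0).
  have -> : b 0 y = 0.
    by have := bZ 0 0 y; rewrite scaler0 => ->; rewrite rmorph0 mul0r.
  by rewrite normc0.
have [y0|y0] := eqVneq (fnorm y) 0.
  by rewrite y0 mulr0 mulr0 (fnorm_eq0 y0) b0 normc0.
have X : 0 < fnorm x by rewrite lt_def x0 fnorm_ge0.
have Y : 0 < fnorm y by rewrite lt_def y0 fnorm_ge0.
have K0 : 0 <= K.
  have : 0 <= K * (fnorm x ^+ 2 + fnorm y ^+ 2).
    by apply: le_trans (bK x y); exact: normc_ge0.
  by rewrite pmulr_lge0// addr_gt0// exprn_gt0.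
set t := fnorm y / fnorm x.
have t0 : 0 < t by rewrite divr_gt0.
rewrite -(ler_pM2l t0); have := bK (t%:C *: x) y.
rewrite bZ normcM normc_real gtr0_norm// => /le_trans; apply.
have tx : t * fnorm x = fnorm y by rewrite divfK.
have -> : t * (2 * K * (fnorm x * fnorm y)) = K * (fnorm y ^+ 2 + fnorm y ^+ 2).
  have -> : t * (2 * K * (fnorm x * fnorm y)) =
      2 * K * ((t * fnorm x) * fnorm y) by ring.
  by rewrite tx; ring.
rewrite ler_wpM2l// lerD2r ler_sqr ?nnegrE ?fnorm_ge0// -tx.
exact: fnormZ_real_le (ltW t0).
Qed.

End inner_product.

(** * Bounded linear forms *)

Section density.
Variables (R : realType) (n : nat).
Implicit Types (f : word n -> R[i]) (x y z : fock R n) (s : seq (word n)).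

(** The family [f] need not be square-summable, so that [riesz] can test a form on coefficients not
    yet known to lie in [l2]. For duplicate-free [s] this is the restriction of [f] to [s]. *)
Definition trunc s f : fock R n := \sum_(w <- s) f w *: xi R w.

Lemma fockB x y w : (x - y) w = x w - y w. Proof. by []. Qed.

Lemma fockZ a x w : (a *: x) w = a * x w. Proof. by []. Qed.

Lemma fock_sumE (I : Type) (s : seq I) (F : I -> fock R n) v :
  (\sum_(i <- s) F i) v = \sum_(i <- s) F i v.
Proof. by elim/big_rec2: _ => // i a b _ <-. Qed.

Lemma truncE s f v : uniq s -> trunc s f v = if v \in s then f v else 0.
Proof.
move=> us; rewrite fock_sumE.
under eq_bigr do rewrite fockZ.
case: ifPn => vs.
  rewrite (bigD1_seq v)//= eqxx mulr1 big1 ?addr0// => w.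
  by rewrite eq_sym /= => /negPf ->; rewrite mulr0.
rewrite big1_seq// => w /andP[_ ws] /=; have [E|_] := eqVneq v w.
  by rewrite E ws in vs.
by rewrite mulr0.
Qed.

Lemma fnorm_trunc s f : uniq s ->
  fnorm (trunc s f) ^+ 2 = \sum_(w <- s) sqnormc (f w).
Proof.
move=> us; apply: EFin_inj; rewrite fnorm_sqr /sqsum (esumID [set` s]); last first.
  by move=> w _; rewrite lee_fin sqnormc_ge0.
rewrite [X in (_ + X)%E]esum1 ?adde0 => [|w [_ /= /negP/negPf ws]]; last first.
  by rewrite truncE// ws /sqnormc /= expr0n addr0.
rewrite setTI esum_fset//=; last by move=> w _; rewrite lee_fin sqnormc_ge0.
rewrite -fsbig_seq// sumEFin; congr EFin; apply: eq_big_seq => w ws.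
by rewrite truncE// ws.
Qed.

Lemma trunc_dense x (e : R) : 0 < e ->
  exists2 s, uniq s & fnorm (x - trunc s x) < e.
Proof.
move=> e0; have e20 : 0 < e ^+ 2 by rewrite exprn_gt0.
(* [sqsum x] is a supremum of finite sums; a finite set [X] within [e ^+ 2] of it leaves a tail of
   norm less than [e]. *)
have [_ [X [finX _] <-]] := ub_ereal_sup_adherent e20 (sqsum_fin x).
rewrite fsbig_finite//=; set s := finmap.enum_fset _ => lt.
have us : uniq s by exact: finmap.fset_uniq.
exists s => //; rewrite -ltr_sqr ?nnegrE ?fnorm_ge0 ?(ltW e0)// -lte_fin fnorm_sqr.
have sX w : (w \in s) = (w \in X) by rewrite in_fset_set.
have E : sqsum x = (\sum_(w <- s) (sqnormc (x w))%:E +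
    sqsum (x - trunc s x : fock R n)%R)%E.
  rewrite /sqsum (esumID X) => [|w _]; last by rewrite lee_fin sqnormc_ge0.
  rewrite setTI esum_fset => [||w _]//; last by rewrite lee_fin sqnormc_ge0.
  rewrite fsbig_finite//; congr (_ + _)%E.
  rewrite [RHS](esumID X) => [|w _]; last by rewrite lee_fin sqnormc_ge0.
  rewrite [X in (X + _)%E]esum1 ?add0e => [|w [_ Xw]]; last first.
    rewrite fockB truncE// sX mem_set//.
    by rewrite subrr /sqnormc /= expr0n addr0.
  apply: eq_esum => w [_ Xw].
  rewrite fockB truncE// sX memNset//.
  by rewrite subr0.
have {}lt : (sqsum x - (e ^+ 2)%:E < \sum_(w <- s) (sqnormc (x w))%:E)%E := lt.
move: lt; rewrite {1}E sumEFin -fnorm_sqr -!EFinD lte_fin => lt.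
by rewrite lte_fin; lra.
Qed.

End density.

Section functional.
Variables (R : realType) (n : nat).
Implicit Types (f : word n -> R[i]) (x y z : fock R n) (s : seq (word n)).
Implicit Types (phi : fock R n -> R[i]).

Lemma linear_form0 phi : scalar phi -> phi 0 = 0.
Proof. by move=> /(_ (-1) 0 0); rewrite scaler0 addr0 mulN1r addNr. Qed.

Lemma linear_formZ phi a x : scalar phi -> phi (a *: x) = a * phi x.
Proof. by move=> lphi; rewrite -[a *: x]addr0 lphi linear_form0// addr0. Qed.

Lemma linear_formD phi x y : scalar phi -> phi (x + y) = phi x + phi y.
Proof. by move=> lphi; rewrite -[x]scale1r lphi scale1r mul1r. Qed.

Lemma linear_formB phi x y : scalar phi -> phi (x - y) = phi x - phi y.
Proof.
by move=> lphi; rewrite linear_formD// -scaleN1r linear_formZ// mulN1r.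
Qed.

Lemma linear_form_sum phi (I : Type) (s : seq I) (F : I -> fock R n) : scalar phi ->
  phi (\sum_(i <- s) F i) = \sum_(i <- s) phi (F i).
Proof.
move=> lphi; elim/big_rec2: _ => [|i a b _ <-]; first exact: linear_form0.
exact: linear_formD.
Qed.

Lemma linear_form_trunc phi s f : scalar phi ->
  phi (trunc s f) = \sum_(w <- s) f w * phi (xi R w).
Proof.
move=> lphi; rewrite linear_form_sum//; apply: eq_bigr => w _.
exact: linear_formZ.
Qed.

Lemma inner_le x y : normc (inner x y) <= 4 * (fnorm x * fnorm y).
Proof.
have -> : 4 = 2 * 2 :> R by ring.
have lin z := inner_linearl z.
apply: homogeneous_bound => [t {}x {}y|{}x|]; last exact: inner_le_sqr.
  exact: linear_formZ (lin y).
by rewrite innerC (linear_form0 (lin x)) conjc0.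
Qed.

Lemma bounded_scalar_eq0 phi (C : R) : scalar phi ->
  (forall x, normc (phi x) <= C * fnorm x) ->
  (forall w, phi (xi R w) = 0) -> forall x, phi x = 0.
Proof.
move=> lphi bphi phi0 x; apply: (@normc_small_eq0 _ _ `|C|) => e e0.
have [s us /ltW se] := trunc_dense x e0.
have -> : phi x = phi (x - trunc s x).
  rewrite linear_formB// linear_form_trunc// big1 ?subr0// => w _.
  by rewrite phi0 mulr0.
apply: le_trans (bphi _) _; apply: (@le_trans _ _ (`|C| * fnorm (x - trunc s x))).
  by rewrite ler_wpM2r ?fnorm_ge0 ?ler_norm.
by rewrite ler_wpM2l.
Qed.

Lemma bounded_scalar_eq phi psi (C D : R) : scalar phi -> scalar psi ->
  (forall x, normc (phi x) <= C * fnorm x) ->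
  (forall x, normc (psi x) <= D * fnorm x) ->
  (forall w, phi (xi R w) = psi (xi R w)) -> phi =1 psi.
Proof.
move=> lphi lpsi bphi bpsi eqxi x; apply/eqP; rewrite -subr_eq0; apply/eqP.
apply: (@bounded_scalar_eq0 (fun x => phi x - psi x) (C + D)) => [a {}x y|{}x|w].
- by rewrite lphi lpsi; ring.
- by apply: le_trans (normcB _ _) _; rewrite mulrDl lerD.
- by rewrite eqxi subrr.
Qed.

(** The representing vector must have coefficients conj(phi(xi_w)); boundedness of [phi] shows that
    they are square-summable, and the two forms then agree on the basis. *)
Lemma riesz phi (C : R) : scalar phi ->
  (forall x, normc (phi x) <= C * fnorm x) -> exists z, forall x, phi x = inner x z.
Proof.
move=> lphi bphi; pose g w := conjc (phi (xi R w)).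
have bnd s : uniq s -> \sum_(w <- s) sqnormc (g w) <= C ^+ 2.
  move=> us; set Q := \sum_(w <- s) _.
  have Q0 : 0 <= Q by apply: sumr_ge0 => w _; exact: sqnormc_ge0.
  (* On the truncation of [g] the form takes the value Q = N^2, where N is the norm of that
     truncation, so N^2 <= C N and hence Q <= C^2. *)
  have := bphi (trunc s g).
  have -> : phi (trunc s g) = Q%:C.
    rewrite linear_form_trunc// rmorph_sum; apply: eq_bigr => w _.
    by rewrite -[phi _]conjcK sqnormc_conjM.
  rewrite normc_real ger0_norm// => QC.
  have := fnorm_trunc g us; rewrite -/Q => QE.
  have N0 := fnorm_ge0 (trunc s g).
  move: QC N0; rewrite -QE; set N := fnorm _ => QC.
  rewrite le_eqVlt => /predU1P[<-|N0]; first by rewrite expr0n sqr_ge0.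
  move: QC; rewrite expr2 ler_pM2r// => NC.
  by rewrite ler_sqr ?nnegrE ?(ltW N0)// (le_trans (ltW N0)).
have gl2 : g \in @l2 R n.
  rewrite /in_mem /= /l2; apply: (@le_lt_trans _ _ (C ^+ 2)%:E); last exact: ltry.
  apply: ge_ereal_sup => _ [X [finX _] <-].
  by rewrite fsbig_finite//= sumEFin lee_fin bnd// finmap.fset_uniq.
exists (Fock gl2); apply: (@bounded_scalar_eq _ _ C (4 * fnorm (Fock gl2))) => //.
- exact: inner_linearl.
- by move=> x; apply: le_trans (inner_le _ _) _; rewrite mulrA mulrAC.
- by move=> w; rewrite innerC inner_xi conjcK.
Qed.

(** The bound [K] does not depend on [N], so replacing [x] by a truncation costs at most half the
    tolerance for all [N] at once; on the truncation only finitely many basis vectors occur. *)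
Lemma bounded_scalar_limit (phi : nat -> fock R n -> R[i]) (K : R) :
  (forall N, scalar (phi N)) ->
  (forall N x, normc (phi N x) <= K * fnorm x) ->
  (forall w, phi N (xi R w) @[N --> \oo] --> (0 : R[i]^o)) ->
  forall x, phi N x @[N --> \oo] --> (0 : R[i]^o).
Proof.
move=> lphi bphi phi0 x; apply/(@cvgr0Pnorm_lt R[i] R[i]^o) => e e0.
have [r r0 eE] := gt0_complexP e0.
(* Adding 1 to [|K|] keeps the denominator positive when [K] is zero. *)
have d0 : 0 < r / (2 * (`|K| + 1)) by rewrite divr_gt0// mulr_gt0// ltr_wpDl.
have [s us /ltW se] := trunc_dense x d0.
have : phi N (trunc s x) @[N --> \oo] --> (0 : R[i]^o).
  have -> : (fun N => phi N (trunc s x)) =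
      (fun N => \sum_(w <- s) x w * phi N (xi R w)).
    by apply/funext => N; rewrite linear_form_trunc.
  elim: s {us se} => [|w s IH].
    have -> : (fun N => \sum_(w <- [::]) x w * phi N (xi R w)) = cst 0.
      by apply/funext => N; rewrite big_nil.
    exact: (@cvg_cst R[i]^o).
  have -> : (fun N => \sum_(v <- w :: s) x v * phi N (xi R v)) =
      (fun N => x w * phi N (xi R w)) \+
      (fun N => \sum_(v <- s) x v * phi N (xi R v)).
    by apply/funext => N; rewrite big_cons.
  rewrite -[X in _ --> X]addr0; apply: (@cvgD R[i] R[i]^o) IH.
  rewrite -[X in _ --> X](mulr0 (x w)); apply: (@cvgMl_tmp R[i]); exact: phi0.
move=> /(@cvgr0Pnorm_lt R[i] R[i]^o) /(_ (r / 2)%:C).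
rewrite ltcR => /(_ (divr_gt0 r0 (ltr0Sn _ _))).
apply: filterS => N; rewrite eE -[`|phi N _|]/(normc _)%:C -[`|phi N x|]/(normc _)%:C.
rewrite !ltcR => lt; have -> : phi N x = phi N (x - trunc s x) + phi N (trunc s x).
  by rewrite linear_formB// subrK.
apply: le_lt_trans (normcD _ _) _; rewrite [r]splitr; apply: ler_ltD => //.
apply: le_trans (bphi _ _) _.
apply: (@le_trans _ _ ((`|K| + 1) * fnorm (x - trunc s x))).
  by rewrite ler_wpM2r ?fnorm_ge0// (le_trans (ler_norm _))// lerDl.
have K1 : 0 < `|K| + 1 by rewrite ltr_wpDl.
by rewrite -ler_pdivlMl// (le_trans se)// invfM mulrA mulrC.
Qed.

End functional.

(** * Weak operator topology *)

Lemma initial_topology_cvg (U : choiceType) (V : topologicalType) (f : U -> V)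
    (I : Type) (F : set_system I) (u : I -> U) (a : U) : Filter F ->
  f (u i) @[i --> F] --> f a -> u i @[i --> F] --> (a : initial_topology f).
Proof.
move=> FF fua A /= [_ [[B Bop <-] Ba sBA]].
have FB : F [set i | B (f (u i))] by apply: fua; rewrite nbhsE; exists B.
by apply: (@filterS _ F FF _ _ _ FB) => i; exact: sBA.
Qed.

Section operators.
Variables (R : realType) (n : nat).
Implicit Types (A B : bop R n) (x y z : fock R n).

Lemma inner_bop_scalar A y : scalar (fun x => inner (A x) y).
Proof. by move=> a x x'; rewrite bop_linear; exact: inner_linearl. Qed.

Lemma bop_coef_scalar A v : scalar (fun x => A x v).
Proof. by move=> a x x'; rewrite bop_linear. Qed.

Lemma inner_bop_bounded A :
  exists2 C : R, 0 <= C &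
    forall x y, normc (inner (A x) y) <= C * (fnorm x * fnorm y).
Proof.
have [M AM] := bop_bounded A; exists (4 * `|M|); first by rewrite mulr_ge0.
move=> x y; apply: le_trans (inner_le _ _) _.
rewrite -mulrA ler_wpM2l// mulrA ler_wpM2r ?fnorm_ge0//.
by apply: le_trans (AM x) _; rewrite ler_wpM2r ?fnorm_ge0 ?ler_norm.
Qed.

Lemma bop_coef_bounded A v : exists C : R, forall x, normc (A x v) <= C * fnorm x.
Proof.
have [C _ hC] := inner_bop_bounded A; exists (C * fnorm (xi R v)) => x.
by rewrite -inner_xi mulrAC -mulrA.
Qed.

Lemma bop_eq_xi A B : (forall w, A (xi R w) = B (xi R w)) -> A = B.
Proof.
move=> AB; apply: bop_ext => x; apply/val_inj/funext => v.
have [C hC] := bop_coef_bounded A v; have [D hD] := bop_coef_bounded B v.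
apply: (bounded_scalar_eq (bop_coef_scalar A v) (bop_coef_scalar B v) hC hD) => w.
by rewrite AB.
Qed.

(** The vector [z] is the adjoint of [A] applied to [xi R v]; these vectors are all that is needed
    of the adjoint. *)
Lemma bop_adjoint_xi A v : exists z, forall x, A x v = inner x z.
Proof.
by have [C hC] := bop_coef_bounded A v; exact: riesz (bop_coef_scalar A v) hC.
Qed.

Lemma wot_coef_continuous x y :
  continuous (fun A : wot R n => inner (A x) y : R[i]^o).
Proof.
move=> A; apply: (@continuous_comp (wot R n) _ _ (@matrix_coef R n)
  (@proj _ (fun=> R[i]^o) (x, y))).
  exact: initial_continuous.
exact: proj_continuous.
Qed.

Lemma wot_cvg (u : nat -> bop R n) A :
  (forall x y, inner ((u N - A) x) y @[N --> \oo] --> (0 : R[i]^o)) ->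
  u N @[N --> \oo] --> (A : wot R n).
Proof.
move=> uA.
have cvgB0 (f : nat -> R[i]) a : f N - a @[N --> \oo] --> (0 : R[i]^o) ->
    f N @[N --> \oo] --> (a : R[i]^o).
  exact: (@subr_cvg0 R[i] R[i]^o _ _ _ _ _).1.
have {}uA x y : inner (u N x) y @[N --> \oo] --> (inner (A x) y : R[i]^o).
  apply: (cvgB0 (fun N => inner (u N x) y)).
  have -> : (fun N => inner (u N x) y - inner (A x) y) =
      (fun N => inner ((u N - A) x) y).
    by apply/funext => N; rewrite -(linear_formB _ _ (inner_linearl y)).
  exact: uA.
apply: (@initial_topology_cvg _ _ (@matrix_coef R n)).
apply/cvg_sup => -[x y].
exact: (@initial_topology_cvg _ R[i]^o (fun g => g (x, y)) _ _ _ _ _ (uA x y)).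
Qed.

Definition centralizer B : set (bop R n) := [set A | A * B = B * A].

Lemma centralizer_subalg_closed B : subalg_closed [in centralizer B].
Proof.
split=> [|a A A'|A A']; rewrite !inE /centralizer /=.
- by rewrite mulr1 mul1r.
- by move=> AB A'B; rewrite mulrDl mulrDr -scalerAl -scalerAr AB A'B.
- by move=> AB A'B; rewrite -mulrA A'B mulrA AB mulrA.
Qed.

Lemma centralizer_closed B : closed (centralizer B : set (wot R n)).
Proof.
have /choice[z zE] : forall v, exists z, forall x, B x v = inner x z.
  exact: bop_adjoint_xi.
(* The (u,v) entry of AB - BA. The entry of BA is written with [z], the adjoint of [B] on a basis
   vector, so that both terms are WOT-continuous coefficients of [A]. *)
pose d (p : word n * word n) (A : wot R n) : R[i]^o :=
  inner (A (B (xi R p.1))) (xi R p.2) - inner (A (xi R p.1)) (z p.2).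
have -> : centralizer B = \bigcap_(p in setT) (d p @^-1` [set 0]).
  apply/seteqP; split=> [A AB [u v] _|A dA].
    have ABx x : A (B x) = B (A x) := congr1 (fun C : bop R n => C x) AB.
    rewrite /preimage /d /= inner_xi -zE.
    by rewrite ABx subrr.
  apply: bop_eq_xi => u; apply/val_inj/funext => v /=.
  have := dA (u, v) I; rewrite /preimage /d /= inner_xi -zE => /eqP.
  by rewrite subr_eq0 => /eqP.
apply: closed_bigI => p _; apply: preimage_closed.
  move=> A _; exact: (@cvgB R[i] R[i]^o _ _ _ _ _ _ _
    (@wot_coef_continuous (B (xi R p.1)) (xi R p.2) A)
    (@wot_coef_continuous (xi R p.1) (z p.2) A)).
apply: (@accessible_closed_set1 R[i]^o); apply: (@hausdorff_accessible R[i]^o).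
exact: (@norm_hausdorff R[i] R[i]^o).
Qed.

(** Centralizers are WOT-closed algebras, so commutation with a fixed operator passes from
    generators to the algebra. This is used twice: first for a fixed element of [H], then for a
    fixed element of [wot_alg G]. *)
Lemma commutant_wot_alg (G H : set (bop R n)) :
  (forall A B, G A -> H B -> A * B = B * A) ->
  wot_alg G `<=` commutant (wot_alg H).
Proof.
move=> GH; have cen (D : set (bop R n)) B : D `<=` centralizer B ->
    wot_alg D `<=` centralizer B.
  move=> DB A; apply; split; last exact: DB.
  by split; [exact: centralizer_subalg_closed|exact: centralizer_closed].
move=> B GB A HA; apply: (cen H) HA => A' HA'.
by apply/esym; apply: (cen G) GB => B' GB'; exact: GH.
Qed.

End operators.

(** * Matrix coefficients of the commutant *)

Section weights.
Variables (R : realType) (n : nat) (lam : 'I_n -> word n -> R).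
Hypothesis lam_gt0 : forall i w, 0 < lam i w.
Implicit Types (u v w : word n) (i j : 'I_n).

Lemma weight_gt0 u w : 0 < weight lam u w.
Proof. by elim: w => //= i w IH; rewrite mulr_gt0. Qed.

Lemma weight_cat u v w :
  weight lam u (w ++ v) = weight lam u v * weight lam (v ++ u) w.
Proof.
by elim: w => [|i w IH] /=; rewrite ?mulr1// IH catA mulrA.
Qed.

Lemma right_weight_gt0 i w : 0 < right_weight lam i w.
Proof. by rewrite divr_gt0 ?weight_gt0. Qed.

(** By [weight_cat], both sides equal W(i,wu) / W(e,u). This identity gives both the commutation of
    the shifts and the propagation of matrix entries. *)
Lemma weight_right_weight i u w :
  weight lam u w * right_weight lam i (w ++ u) =
  right_weight lam i u * weight lam (rcons u i) w.
Proof.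
rewrite /right_weight !weight_cat cats0 cats1.
have := weight_gt0 [::] u; have := weight_gt0 u w.
by rewrite !lt_def => /andP[a0 _] /andP[b0 _]; field; rewrite a0 b0.
Qed.

End weights.

(** * Left and right shifts, and operators commuting with the right shifts *)

Section weighted_shifts.
Variables (R : realType) (n : nat) (lam : 'I_n -> word n -> R).
Variables T S : 'I_n -> bop R n.
Hypotheses (shiftT : weighted_shift lam T) (shiftS : right_shift lam S).
Implicit Types (A : bop R n) (u v w : word n) (i j : 'I_n) (z : fock R n).

Let lam_gt0 i w : 0 < lam i w. Proof. by case: shiftT. Qed.
Let T_xi i w : T i (xi R w) = (lam i w)%:C *: xi R (i :: w).
Proof. by case: shiftT. Qed.

Lemma shifts_commute i j : T i * S j = S j * T i.
Proof.
apply: bop_eq_xi => w; rewrite -[LHS]/(T i (S j (xi R w))).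
rewrite -[RHS]/(S j (T i (xi R w))) shiftS T_xi !linearZ /= T_xi shiftS.
rewrite !scalerA rcons_cons; congr (_ *: _); rewrite -!rmorphM; congr (_%:C).
(* The required equality of weights is the case of the one-letter word [[:: i]]. *)
by have := weight_right_weight lam_gt0 j w [:: i]; rewrite /= !mul1r => ->.
Qed.

Definition word_shift w : bop R n := foldr (fun i A => T i * A) 1 w.

Lemma word_shift_xi w u :
  word_shift w (xi R u) = (weight lam u w)%:C *: xi R (w ++ u).
Proof.
elim: w => [|i w IH] /=; first by rewrite scale1r.
rewrite -[LHS]/(T i (word_shift w (xi R u))) IH linearZ /= T_xi scalerA.
by rewrite rmorphM.
Qed.

(** Both sides are bounded linear forms in [z], so they need only be compared on basis vectors. *)
Lemma right_shift_coef i z v :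
  S i z (rcons v i) = (right_weight lam i v)%:C * z v.
Proof.
have [C hC] := bop_coef_bounded (S i) (rcons v i).
have [D hD] := bop_coef_bounded (1 : bop R n) v.
apply: (bounded_scalar_eq (bop_coef_scalar (S i) (rcons v i)) _ hC
  (psi := fun z => (right_weight lam i v)%:C * z v)
  (D := normc (right_weight lam i v)%:C * D)) => [a x y|x|w].
- by rewrite -[(a *: x + y) v]/(a * x v + y v); ring.
- by rewrite normcM -mulrA ler_wpM2l ?normc_ge0//; exact: hD.
- rewrite shiftS fockZ /= (inj_eq (@rcons_injl _ i)).
  by have [->|_] := eqVneq v w; rewrite ?mulr0.
Qed.

Lemma right_shift_coef_eq0 i z v : (forall u, v <> rcons u i) -> S i z v = 0.
Proof.
move=> vi; have [C hC] := bop_coef_bounded (S i) v.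
apply: (bounded_scalar_eq0 (bop_coef_scalar (S i) v) hC) => w.
by rewrite shiftS fockZ /=; case: eqP => [/vi//|]; rewrite mulr0.
Qed.

Section commuting_operator.
Variable A : bop R n.
Hypothesis AS : forall i, A * S i = S i * A.

(** The coefficients of the formal expansion of [A] in the operators [word_shift T w]; the division
    is there because T_w sends xi_e to W(e,w) xi_w. *)
Definition symbol w : R[i] := A (xi R [::]) w / (weight lam [::] w)%:C.

Let right_weightC_neq0 i u : (right_weight lam i u)%:C != 0 :> R[i].
Proof. by rewrite (inj_eq (@complexI R)) gt_eqF// right_weight_gt0. Qed.

(** Up to a nonzero scalar, xi_(ui) is S_i xi_u, and [A] moves past S_i. Hence [A] is determined by
    its value on the empty word, by induction on the last letter. *)
Let A_xi_rcons u i :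
  A (xi R (rcons u i)) = (right_weight lam i u)%:C^-1 *: S i (A (xi R u)).
Proof.
rewrite -[S i (A _)]/((S i * A) _) -AS -[(A * S i) _]/(A (S i _)) shiftS.
by rewrite linearZ scalerA mulVf ?scale1r// right_weightC_neq0.
Qed.

Lemma symbol_coef u w :
  A (xi R u) (w ++ u) = symbol w * (weight lam u w)%:C.
Proof.
elim/last_ind: u w => [|u i IH] w.
  rewrite cats0 divfK// (inj_eq (@complexI R)) gt_eqF//.
  exact: weight_gt0.
rewrite A_xi_rcons -rcons_cat fockZ right_shift_coef IH.
(* Multiplying by the right weight clears its inverse and leaves [weight_right_weight]. *)
apply: (mulfI (right_weightC_neq0 i u)).
rewrite mulVKf ?right_weightC_neq0//.
have /(congr1 (fun c => c%:C)) := weight_right_weight lam_gt0 i u w.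
rewrite !rmorphM /= => E.
by rewrite mulrCA [X in _ * X]mulrC E; ring.
Qed.

(** The range of S_i is supported on words ending in [i], so the suffix [u] is peeled off letter by
    letter from the right. *)
Lemma symbol_coef_eq0 u v : (forall w, v <> w ++ u) -> A (xi R u) v = 0.
Proof.
elim/last_ind: u v => [|u i IH] v vu; first by case: (vu v); rewrite cats0.
rewrite A_xi_rcons fockZ.
have [[v' vE]|vi] := pselect (exists v', v = rcons v' i).
  rewrite vE right_shift_coef IH ?mulr0// => w v'E.
  by apply: (vu w); rewrite vE v'E rcons_cat.
by rewrite right_shift_coef_eq0 ?mulr0// => v' vE; apply: vi; exists v'.
Qed.

End commuting_operator.
End weighted_shifts.

(** * Cesaro means *)

Definition window (N m a : nat) : bool := (a <= m < a + N)%N.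

(** The two windows meet in [b, a+N), which lies below [M]. Truncated subtraction returns 0 when
    they are disjoint, as the positive part in the kernel requires. *)
Lemma window_count N M a b : (a <= b)%N -> (b + N <= M)%N ->
  (\sum_(m < M) window N m a * window N m b = N - (b - a))%N.
Proof.
move=> ab bM; have count c : (\sum_(m < c) ((b <= m < a + N) : nat) =
    minn c (a + N) - b)%N.
  elim: c => [|c IH]; first by rewrite big_ord0; lia.
  by rewrite big_ord_recr /= IH; case: (b <= c < a + N)%N / boolP; lia.
rewrite (eq_bigr (fun m : 'I_M => (b <= m < a + N) : nat)); last first.
  by move=> m _; rewrite mulnb; congr nat_of_bool; rewrite /window; lia.
by rewrite count; lia.
Qed.

Lemma window_count_le N M a : (\sum_(m < M) window N m a <= N)%N.
Proof.
(* Enlarging the range makes the count exact, by [window_count] with both windows equal; the extra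
   terms are then dropped. *)
have E : (\sum_(m < M + (a + N)) window N m a * window N m a = N - (a - a))%N.
  by apply: window_count; rewrite ?leq_addl.
rewrite subnn subn0 in E; rewrite -[leqRHS]E.
rewrite big_split_ord /= -[leqLHS]addn0 leq_add//.
by apply: leq_sum => m _; rewrite mulnb andbb.
Qed.

(** The double sum runs once over each word of length less than [N], so at most one term
    survives. *)
Lemma sum_tuples_pred1 (V : nmodType) (I : finType) (F : seq I -> V) (w : seq I) N :
  (forall v, v <> w -> F v = 0) ->
  \sum_(k < N) \sum_(t : k.-tuple I) F t = if (size w < N)%N then F w else 0.
Proof.
move=> F0; case: ifPn => wN; last first.
  rewrite big1// => k _; rewrite big1// => t _; apply: F0 => tw.
  by rewrite -tw size_tuple ltn_ord in wN.
rewrite (bigD1 (Ordinal wN))//= [X in _ + X]big1 ?addr0 => [|k kw]; last first.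
  rewrite big1// => t _; apply: F0 => tw; move/eqP: kw; apply.
  by apply/val_inj; rewrite /= -tw size_tuple.
rewrite (bigD1 (in_tuple w))//= big1 ?addr0// => t tw; apply: F0 => tE.
by move/eqP: tw; apply; apply/val_inj.
Qed.

(** * Sesquilinear forms on truncated vectors *)

Section truncated_forms.
Variables (R : realType) (n : nat).
Implicit Types (f g : word n -> R[i]) (B : bop R n) (x y z : fock R n).
Implicit Types (s t : seq (word n)).

Lemma fnorm_trunc_le s x : uniq s -> fnorm (trunc s x) <= fnorm x.
Proof.
move=> us; rewrite -ler_sqr ?nnegrE ?fnorm_ge0// fnorm_trunc// -lee_fin fnorm_sqr.
apply: esum_ge; exists [set` s]; first by split=> //; exact: finite_seq.
by rewrite -fsbig_seq// sumEFin.
Qed.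

Lemma innerBr x y z : inner x (y - z) = inner x y - inner x z.
Proof.
rewrite innerC (linear_formB _ _ (inner_linearl _)) rmorphB.
by congr (_ - _); rewrite [RHS]innerC.
Qed.

Lemma inner_trunc B s t f g :
  inner (B (trunc s f)) (trunc t g) =
  \sum_(u <- s) \sum_(v <- t) f u * (conjc (g v) * B (xi R u) v).
Proof.
rewrite (linear_form_trunc _ _ (inner_bop_scalar B (trunc t g))).
apply: eq_bigr => u _; rewrite -mulr_sumr innerC.
rewrite (linear_form_trunc _ _ (inner_linearl _)) rmorph_sum; congr (_ * _).
apply: eq_bigr => v _; rewrite innerC inner_xi rmorphM.
by rewrite -[X in _ * X]/(conjc (conjc _)) conjcK.
Qed.

(** The bound [K] coming from boundedness of [B] only controls the truncation errors, so the
    constant [C] survives the passage to the limit unchanged. This is what keeps bounds uniform over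
    a family of operators. *)
Lemma inner_bop_bound_dense B (C : R) : 0 <= C ->
  (forall s t x y, uniq s -> uniq t ->
    normc (inner (B (trunc s x)) (trunc t y)) <= C * (fnorm x * fnorm y)) ->
  forall x y, normc (inner (B x) y) <= C * (fnorm x * fnorm y).
Proof.
move=> C0 BC x y; have [K K0 BK] := inner_bop_bounded B.
(* With truncation errors at most d, the two error terms add up to at most P d, and d = e / (P + 1)
   makes this at most [e]. *)
pose P := K * (fnorm x + fnorm y).
have P0 : 0 <= P by rewrite mulr_ge0// addr_ge0 ?fnorm_ge0.
apply/ler_addgt0Pl => e e0.
have d0 : 0 < e / (P + 1) by rewrite divr_gt0// ltr_wpDl.
have [s us /ltW se] := trunc_dense x d0; have [t ut /ltW te] := trunc_dense y d0.
set d := e / (P + 1) in d0 se te.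
have -> : inner (B x) y = inner (B (x - trunc s x)) y +
    (inner (B (trunc s x)) (y - trunc t y) + inner (B (trunc s x)) (trunc t y)).
  rewrite (linear_formB _ _ (inner_bop_scalar B y)).
  by rewrite innerBr !subrK.
apply: le_trans (normcD _ _) _.
apply: (@le_trans _ _ (K * (d * fnorm y) + (K * (fnorm x * d) +
    C * (fnorm x * fnorm y)))).
  apply: lerD.
    by apply: le_trans (BK _ _) _; rewrite ler_wpM2l// ler_wpM2r// fnorm_ge0.
  apply: le_trans (normcD _ _) _; apply: lerD; last exact: BC.
  apply: le_trans (BK _ _) _; rewrite ler_wpM2l// ler_pM ?fnorm_ge0//.
  exact: fnorm_trunc_le.
have : P * d <= e.
  by rewrite /d mulrCA ger_pMr// ler_pdivrMr ?mul1r ?lerDl// ltr_wpDl.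
by rewrite /P; lra.
Qed.

End truncated_forms.

Lemma cvg0_conj (R : realType) (u : nat -> R[i]) :
  u N @[N --> \oo] --> (0 : R[i]^o) -> conjc (u N) @[N --> \oo] --> (0 : R[i]^o).
Proof.
move=> /(@cvgr0Pnorm_lt R[i] R[i]^o) u0.
apply/(@cvgr0Pnorm_lt R[i] R[i]^o) => e /u0; apply: filterS => N.
by rewrite (_ : `|conjc (u N)| = `|u N|)// normcJ.
Qed.

Section cesaro_means.
Variables (R : realType) (n : nat) (lam : 'I_n -> word n -> R).
Variables T S : 'I_n -> bop R n.
Hypotheses (shiftT : weighted_shift lam T) (shiftS : right_shift lam S).
Variable A : bop R n.
Hypothesis AS : forall i, A * S i = S i * A.
Implicit Types (u v w : word n) (x y : fock R n) (s t : seq (word n)).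

(** The subtraction is in the natural numbers, so the weight vanishes for [k] greater than [N]. *)
Definition cesaro_weight N k : R := (N.+1 - k)%:R / N.+1%:R.

Definition cesaro N : bop R n :=
  \sum_(k < N.+1) \sum_(t : k.-tuple 'I_n)
    ((cesaro_weight N k)%:C * symbol lam A t) *: word_shift T t.

Lemma bop_sumE (I : Type) (r : seq I) (P : pred I) (F : I -> bop R n) x v :
  (\sum_(i <- r | P i) F i) x v = \sum_(i <- r | P i) F i x v.
Proof. by elim/big_rec2: _ => // i a b _ <-. Qed.

Lemma cesaro_coef N u v :
  cesaro N (xi R u) v = (cesaro_weight N (size v - size u))%:C * A (xi R u) v.
Proof.
pose F w : R[i] := (cesaro_weight N (size w))%:C * symbol lam A w *
  ((weight lam u w)%:C * (v == w ++ u)%:R).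
have -> : cesaro N (xi R u) v = \sum_(k < N.+1) \sum_(t : k.-tuple 'I_n) F t.
  rewrite bop_sumE; apply: eq_bigr => k _; rewrite bop_sumE; apply: eq_bigr => t _.
  rewrite -[LHS]/(_ * (word_shift T t (xi R u) v)) (word_shift_xi shiftT) fockZ.
  by rewrite /F size_tuple.
have [[w vE]|vu] := pselect (exists w, v = w ++ u); last first.
  rewrite (symbol_coef_eq0 shiftT shiftS AS) ?mulr0 => [|w vE]; last first.
    by apply: vu; exists w.
  rewrite big1// => k _; rewrite big1// => t _; rewrite /F.
  by case: eqP => [vE|_]; [case: vu; exists t|rewrite !mulr0].
rewrite (sum_tuples_pred1 (w := w)) => [|t tw]; last first.
  rewrite /F vE; case: eqP => [E|_]; last by rewrite !mulr0.
  have sz : size w = size t.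
    by apply: (@addIn (size u)); rewrite -!size_cat E.
  by move/eqP: E; rewrite eqseq_cat// => /andP[/eqP wt _]; case: tw.
rewrite /F vE (symbol_coef shiftT shiftS AS) size_cat addnK eqxx mulr1.
(* If [w] is longer than [N], it is absent from the sum, and its weight is zero by truncation. *)
case: ltnP => [_|Nw]; first by rewrite mulrA.
by rewrite /cesaro_weight (eqP (Nw : _ == 0)%N) mul0r rmorph0 mul0r.
Qed.

Lemma cesaro_weightE N M a b : (a <= b)%N -> (b + N.+1 <= M)%N ->
  cesaro_weight N (b - a) =
  N.+1%:R^-1 * \sum_(m < M) (window N.+1 m a)%:R * (window N.+1 m b)%:R.
Proof.
move=> ab bM; rewrite /cesaro_weight -(window_count ab bM) mulrC natr_sum.
by congr (_ * _); apply: eq_bigr => m _; rewrite natrM.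
Qed.

Lemma cesaro_trunc_bound (C : R) N s t x y : uniq s -> uniq t ->
  (forall x y, normc (inner (A x) y) <= C * (fnorm x * fnorm y)) ->
  0 <= C ->
  normc (inner (cesaro N (trunc s x)) (trunc t y)) <=
    C * (fnorm x ^+ 2 + fnorm y ^+ 2).
Proof.
move=> us ut AC C0.
(* Large enough to contain the whole window of every length occurring in [t], as [cesaro_weightE]
   requires. *)
pose M := (\max_(v <- t) size v + N.+1)%N.
(* The projection Q_m, onto words of length between m-N and m. *)
pose cut m (z : fock R n) w : R[i] := (window N.+1 m (size w))%:R * z w.
have -> : inner (cesaro N (trunc s x)) (trunc t y) = (N.+1%:R^-1)%:C *
    \sum_(m < M) inner (A (trunc s (cut m x))) (trunc t (cut m y)).
  rewrite inner_trunc; under [in RHS]eq_bigr do rewrite inner_trunc.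
  rewrite [in RHS]exchange_big mulr_sumr; apply: eq_bigr => u _.
  rewrite [in RHS]exchange_big mulr_sumr; apply: eq_big_seq => v vt.
  rewrite cesaro_coef.
  (* The kernel formula is available only for |u| <= |v|; otherwise the entry of [A] is zero. *)
  have [uv|uv] := leqP (size u) (size v); last first.
    rewrite (symbol_coef_eq0 shiftT shiftS AS) ?mulr0 => [|w vE]; last first.
      by move: uv; rewrite vE size_cat ltnNge leq_addl.
    by rewrite big1 ?mulr0// => m _; rewrite !mulr0.
  rewrite (@cesaro_weightE _ M)//; last first.
    by rewrite leq_add2r (@leq_bigmax_seq _ t predT size).
  rewrite rmorphM rmorph_sum.
  rewrite [_ * A _ _]mulrC 2!mulrA mulrCA mulr_sumr; congr (_ * _).
  apply: eq_bigr => m _; rewrite /cut !rmorphM !rmorph_nat.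
  ring.
(* Each word survives at most N+1 of the cuts; this factor cancels the 1/(N+1) of the average and
   makes the bound independent of [N]. *)
have sqN z r : uniq r -> \sum_(m < M) fnorm (trunc r (cut m z)) ^+ 2 <=
    N.+1%:R * fnorm z ^+ 2.
  move=> ur; apply: (@le_trans _ _ (N.+1%:R * fnorm (trunc r z) ^+ 2)); last first.
    by rewrite ler_wpM2l// ler_sqr ?nnegrE ?fnorm_ge0 ?fnorm_trunc_le.
  under eq_bigr do rewrite fnorm_trunc//.
  rewrite fnorm_trunc// exchange_big mulr_sumr; apply: ler_sum => w _.
  rewrite (eq_bigr (fun m : 'I_M => (window N.+1 m (size w))%:R * sqnormc (z w))).
    rewrite -mulr_suml ler_wpM2r ?sqnormc_ge0// -natr_sum ler_nat.
    exact: window_count_le.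
  by move=> m _; rewrite /cut sqnormcM; case: window;
    rewrite /sqnormc /= ?expr0n ?expr1n ?addr0.
rewrite normcM normc_real ger0_norm ?invr_ge0// ler_pdivrMl ?ltr0n//.
apply: le_trans (normc_sum _ _) _.
apply: (@le_trans _ _ (\sum_(m < M)
    C * (fnorm (trunc s (cut m x)) ^+ 2 + fnorm (trunc t (cut m y)) ^+ 2))).
  apply: ler_sum => m _; apply: le_trans (AC _ _) _; rewrite ler_wpM2l//.
  set p := fnorm _; set q := fnorm _.
  by have := sqr_ge0 (p - q); have := sqr_ge0 p; have := sqr_ge0 q;
    rewrite !expr2; nra.
rewrite -mulr_sumr big_split /= mulrCA ler_wpM2l// mulrDr lerD//; exact: sqN.
Qed.

(** The bound by squares on truncated vectors becomes a bound by a product, since truncation is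
    homogeneous; density then removes the truncations. *)
Lemma cesaro_uniformly_bounded : exists K : R, forall N x y,
  normc (inner (cesaro N x) y) <= K * (fnorm x * fnorm y).
Proof.
have [C C0 AC] := inner_bop_bounded A; exists (2 * C) => N.
apply: inner_bop_bound_dense; first by rewrite mulr_ge0.
move=> s t x y us ut; pose b x y := inner (cesaro N (trunc s x)) (trunc t y).
have truncZ r a (z : fock R n) : trunc r (a *: z) = a *: trunc r z.
  by rewrite scaler_sumr; apply: eq_bigr => w _; rewrite scalerA.
apply: (@homogeneous_bound _ _ b) => [c {}x {}y|{}x|{}x {}y].
- rewrite /b truncZ.
  exact: (linear_formZ _ _ (inner_bop_scalar (cesaro N) (trunc t y))).
- rewrite /b; have -> : trunc t (0 : fock R n) = 0.
    by rewrite /trunc big1// => w _; exact: scale0r.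
  by rewrite innerC (linear_form0 (inner_linearl _)) conjc0.
- exact: cesaro_trunc_bound.
Qed.

Lemma cesaro_weight_cvg k :
  (cesaro_weight N k - 1)%:C @[N --> \oo] --> (0 : R[i]^o).
Proof.
apply/(@cvgr0Pnorm_lt R[i] R[i]^o) => e e0.
have [r r0 ->] := gt0_complexP e0.
(* For fixed [k] the weight differs from 1 by at most k/(N+1). *)
have h : k%:R * harmonic N @[N --> \oo] --> (0 : R^o).
  rewrite -[X in _ --> X](mulr0 (k%:R : R)); apply: cvgMl_tmp.
  exact: cvg_harmonic.
have /(@cvgr0Pnorm_lt R R^o) /(_ r r0) := h; apply: filterS => N hN.
rewrite -[`|_%:C|]/(normc _)%:C ltcR normc_real.
apply: le_lt_trans hN; rewrite /cesaro_weight /=.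
rewrite [leRHS]ger0_norm ?mulr_ge0// ?invr_ge0//.
have -> : (N.+1 - k)%:R / N.+1%:R - 1 = ((N.+1 - k)%:R - N.+1%:R) / N.+1%:R :> R.
  by rewrite mulrBl divff ?pnatr_eq0.
rewrite normrM.
rewrite [X in _ * X]ger0_norm ?invr_ge0// ler_wpM2r ?invr_ge0//.
have [kN|Nk] := leqP k N.+1.
  by rewrite natrB// addrAC subrr sub0r normrN ger0_norm.
rewrite (eqP (ltnW Nk : _ == 0)%N) sub0r normrN ger0_norm// ler_nat.
exact: ltnW.
Qed.

Lemma cesaro_cvg : cesaro N @[N --> \oo] --> (A : wot R n).
Proof.
have [K hK] := cesaro_uniformly_bounded; have [C C0 hC] := inner_bop_bounded A.
apply: wot_cvg => x y.
pose E N := cesaro N - A.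
have EE N z y' : inner (E N z) y' = inner (cesaro N z) y' - inner (A z) y'.
  exact: linear_formB (inner_linearl y').
have hE N z y' : normc (inner (E N z) y') <= (K + C) * (fnorm z * fnorm y').
  by rewrite EE; apply: le_trans (normcB _ _) _; rewrite mulrDl lerD.
(* The left vector is extended from basis vectors to all of Fock space first, with a basis vector on
   the right. *)
have Ex v z : inner (E N z) (xi R v) @[N --> \oo] --> (0 : R[i]^o).
  apply: (@bounded_scalar_limit _ _ (fun N z => inner (E N z) (xi R v))
    ((K + C) * fnorm (xi R v))) => [N|N z'|u].
  - exact: inner_bop_scalar.
  - by rewrite mulrAC -mulrA.
  - have -> : (fun N => inner (E N (xi R u)) (xi R v)) = (fun N =>
        A (xi R u) v * (cesaro_weight N (size v - size u) - 1)%:C).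
      apply/funext => N; rewrite EE !inner_xi cesaro_coef.
      by rewrite rmorphB rmorph1 mulrBr mulr1 [RHS]addrC [RHS]addrC mulrC.
    rewrite -[X in _ --> X](mulr0 (A (xi R u) v)); apply: (@cvgMl_tmp R[i]).
    exact: cesaro_weight_cvg.
(* The form is conjugate-linear on the right, so the right vector is extended after exchanging the
   arguments by conjugation. *)
have Ey : inner y (E N x) @[N --> \oo] --> (0 : R[i]^o).
  apply: (@bounded_scalar_limit _ _ (fun N z => inner z (E N x))
    ((K + C) * fnorm x)) => [N|N z|v].
  - exact: inner_linearl.
  - by rewrite innerC normc_conj -mulrA.
  - have -> : (fun N => inner (xi R v) (E N x)) =
        (fun N => conjc (inner (E N x) (xi R v))).
      by apply/funext => N; rewrite -innerC.
    exact: cvg0_conj.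
have -> : (fun N => inner ((cesaro N - A) x) y) =
    (fun N => conjc (inner y (E N x))).
  by apply/funext => N; rewrite -innerC.
exact: cvg0_conj.
Qed.

Lemma cesaro_subalg (D : set (bop R n)) N :
  subalg_closed [in D] -> range T `<=` D -> cesaro N \in D.
Proof.
move=> [D1 Dlin DM] TD.
(* [subalg_closed] supplies 1 and combinations a A + B, so zero is obtained as -1 + 1. *)
have D0 : 0 \in D by have := Dlin (-1) 1 1 D1 D1; rewrite scaleN1r addNr.
have Dsum (I : Type) (r : seq I) (F : I -> bop R n) :
    (forall i, F i \in D) -> \sum_(i <- r) F i \in D.
  move=> FD; elim/big_rec: _ => // i a _ aD.
  by have := Dlin 1 _ _ (FD i) aD; rewrite scale1r.
apply: (Dsum) => k; apply: (Dsum) => t; rewrite -[_ *: _]addr0.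
apply: Dlin => //; elim: (t : seq _) => [|i w IH] //=.
by apply: DM => //; apply/mem_set/TD; exists i.
Qed.

End cesaro_means.

Theorem theorem2p3 (R : realType) (n : nat) (lam : 'I_n -> word n -> R)
    (T S : 'I_n -> bop R n) :
  (2 <= n)%N ->
  weighted_shift lam T ->
  has_ubound [set right_weight lam p.1 p.2 | p in [set: 'I_n * word n]] ->
  right_shift lam S ->
  commutant (wot_alg (range S)) = wot_alg (range T).
Proof.
move=> _ shiftT _ shiftS; apply/seteqP; split=> [A AS D [[algD closedD] TD]|].
  have {}AS i : A * S i = S i * A.
    by apply/esym/(AS (S i)) => D' [_]; apply; exists i.
  (* [D] is an arbitrary WOT-closed algebra containing the T_i. It contains every Cesaro mean, hence
     their limit [A]. *)
  apply: (closed_cvg (V := wot R n) _ closedD _ _ (cesaro_cvg shiftT shiftS AS)).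
  apply: nearW => N; apply/set_mem.
  exact: cesaro_subalg.
apply: commutant_wot_alg => _ _ [i _ <-] [j _ <-].
exact: shifts_commute shiftT shiftS i j.
Qed.
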